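(* Let $R$ be a unique factorization domain, let $n\geq 2$, let $f,g\in R[X]$ be monic polynomials of degree $n$ with companion matrices $C,D\in M_n(R)$, respectively, and set $h=f/\gcd(f,g)$. Let $P_1,\dots,P_{n-1}\in R[X,Y]$ be the explicit polynomials defined in the context or, more generally, be arbitrary elements of $R[X,Y]$ satisfying $$D^jC=P_j(C,D),\quad j=1,\dots,n-1.$$ Then, via $X\mapsto C$, $Y\mapsto D$, the algebra $R\langle C,D\rangle$ has presentation $$\langle X,Y\,|\, f(X)=0,\ g(Y)=0,\ h(X)(X-Y)=0,\ Y^jX=P_j(X,Y),\ j=1,\dots,n-1\rangle.$$
   Context: The companion matrix of a monic polynomial $f=f_0+f_1X+\cdots+f_{n-1}X^{n-1}+X^n\in R[X]$ is the matrix in $M_n(R)$ whose $j$-th column is $e_{j+1}$ for $1\leq j\leq n-1$ and whose last column is $(-f_0,-f_1,\dots,-f_{n-1})^t$, where $e_1,\dots,e_n$ is the canonical basis of the column space $R^n$. $R\langle C,D\rangle$ denotes the (unital) $R$-subalgebra of $M_n(R)$ generated by $C$ and $D$. The greatest common divisor is taken in $R[X]$ and chosen monic. $R\langle X,Y\rangle$ is the free (noncommutative, unital) $R$-algebra on $X,Y$, and in this setting $R[X,Y]$ denotes the $R$-submodule of $R\langle X,Y\rangle$ spanned by the monomials $X^iY^j$, $i,j\geq 0$ (powers of $X$ to the left of powers of $Y$). For $P\in R[X,Y]$, $P(C,D)$ is the image of $P$ under the $R$-algebra homomorphism $R\langle X,Y\rangle\to M_n(R)$ sending $X\mapsto C$,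 $Y\mapsto D$. A presentation $\langle X,Y\,|\,\text{relations}\rangle$ means the quotient of $R\langle X,Y\rangle$ by the two-sided ideal generated by the relations. The explicit polynomials $P_j$: let $s=g-f$ (a polynomial of degree less than $n$), let $a_j$ be the $(n,j)$-entry of the matrix $s(D)$, let $p_j(X)=X^j-a_1X^{j-1}-\cdots-a_{j-1}X-a_j$ for $1\leq j\leq n-1$, and set $P_j(X,Y)=p_j(X)(X-Y)+Y^{j+1}$ for $1\leq j\leq n-1$. (These satisfy $D^jC=P_j(C,D)$.) *)

(* Defs.v *)
From HB Require Import structures.
From mathcomp Require Import all_boot all_order all_algebra.
From mathcomp Require Import boolp.
From mathcomp Require Import monalg.

Set Implicit Arguments.
Unset Strict Implicit.
Unset Printing Implicit Defensive.

Import GRing.Theory.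
Local Open Scope ring_scope.
Local Open Scope quotient_scope.

Section UFD.
Variable R : idomainType.

Definition irreducible_elt (a : R) : Prop :=
  [/\ a != 0, a \isn't a GRing.unit &
      forall b c, a = b * c -> b \is a GRing.unit \/ c \is a GRing.unit].

Definition associates (a b : R) : Prop :=
  exists2 u, u \is a GRing.unit & b = u * a.

Definition is_ufd : Prop :=
  (forall a : R, a != 0 -> a \isn't a GRing.unit ->
     exists2 s : seq R, (forall p, p \in s -> irreducible_elt p) &
       a = \prod_(p <- s) p) /\
  (forall s t : seq R,
     (forall p, p \in s -> irreducible_elt p) ->
     (forall p, p \in t -> irreducible_elt p) ->
     \prod_(p <- s) p = \prod_(p <- t) p ->
     exists t' : seq R, [/\ perm_eq t t', size t' = size s &
       forall i, (i < size s)%N -> associates s`_i t'`_i]).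

End UFD.

(* Divisibility in R[X] itself; for R not a field, polydiv's [%|] and [gcdp]
   are the notions over the fraction field of R. *)
Definition divides_poly (R : comNzRingType) (p q : {poly R}) : Prop :=
  exists r, q = r * p.

Definition is_monic_gcd (R : comNzRingType) (f g d : {poly R}) : Prop :=
  [/\ d \is monic, divides_poly d f, divides_poly d g &
      forall e, divides_poly e f -> divides_poly e g -> divides_poly e d].

(* The transpose of mathcomp's [companionmx]. *)
Definition companion_col (R : nzRingType) (n : nat) (f : {poly R}) : 'M[R]_n :=
  \matrix_(i < n, j < n)
    if j.+1 == n :> nat then - f`_i else (i == j.+1 :> nat)%:R.

Section Generated.
Variables (R : nzRingType) (A : lalgType R).

Definition subalg_gen (G : A -> Prop) (a : A) : Prop :=
  forall S : {pred A}, GRing.subalg_closed S ->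
    (forall x, G x -> x \in S) -> a \in S.

Definition ideal_closed (I : {pred A}) : Prop :=
  [/\ 0 \in I, {in I &, forall u v, u + v \in I} &
      forall a b, {in I, forall u, a * u * b \in I}].

Definition ideal_gen (G : A -> Prop) : {pred A} := fun a =>
  `[< forall I : {pred A}, ideal_closed I ->
        (forall x, G x -> x \in I) -> a \in I >].

Lemma ideal_gen_closed G : ideal_closed (ideal_gen G).
Proof.
split=> [|u v /asboolP uI /asboolP vI|a b u /asboolP uI];
  apply/asboolP=> I clI GI; case: (clI) => I0 ID IM //.
- by apply: ID; [apply: uI | apply: vI].
- by apply: IM; apply: uI.
Qed.

Lemma ideal_gen_zmod_closed G : zmod_closed (ideal_gen G).
Proof.
have [I0 ID IM] := ideal_gen_closed G; split=> // u v uI vI.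
by apply: ID => //; rewrite -[- v]mulr1 -[v]mul1r -mulNr; apply: IM.
Qed.

HB.instance Definition _ G :=
  GRing.isZmodClosed.Build A (ideal_gen G) (ideal_gen_zmod_closed G).

Lemma ideal_genMl G a u : u \in ideal_gen G -> a * u \in ideal_gen G.
Proof.
by have [_ _ IM] := ideal_gen_closed G => /(IM a 1); rewrite mulr1.
Qed.

Lemma ideal_genMr G b u : u \in ideal_gen G -> u * b \in ideal_gen G.
Proof.
by have [_ _ IM] := ideal_gen_closed G => /(IM 1 b); rewrite mul1r.
Qed.

End Generated.

(* The quotient of A by the two-sided ideal generated by G.  It may be the
   zero ring, so it only gets a possibly trivial ring structure (and an
   R-module structure). *)
Definition quot_alg (R : nzRingType) (A : lalgType R) (G : A -> Prop) :=
  Quotient.quot (ideal_gen G).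

Section QuotAlg.
Variables (R : nzRingType) (A : lalgType R) (G : A -> Prop).
Local Notation Q := (quot_alg G).

HB.instance Definition _ := GRing.Zmodule.on Q.
HB.instance Definition _ : EqQuotient A (Quotient.equiv (ideal_gen G)) Q :=
  EqQuotient.on Q.

Definition quot_pi (a : A) : Q := \pi_Q a.

Lemma quot_piP a b : reflect (quot_pi a = quot_pi b) (a - b \in ideal_gen G).
Proof. by apply: (iffP idP); rewrite /quot_pi Quotient.idealrBE => /eqP. Qed.

Lemma quot_piD a b : quot_pi (a + b) = quot_pi a + quot_pi b.
Proof. exact: Quotient.pi_add. Qed.

Lemma quot_pi_repr q : quot_pi (repr q) = q.
Proof. exact: reprK. Qed.

Definition quot_one : Q := quot_pi 1.
Definition quot_mul (p q : Q) : Q := quot_pi (repr p * repr q).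
Definition quot_scale (c : R) (q : Q) : Q := quot_pi (c *: repr q).

Lemma repr_quot_pi a : repr (quot_pi a) - a \in ideal_gen G.
Proof. by apply/quot_piP; rewrite quot_pi_repr. Qed.

Lemma quot_piM a b : quot_pi (a * b) = quot_mul (quot_pi a) (quot_pi b).
Proof.
apply/esym/quot_piP; set a' := repr _; set b' := repr _.
rewrite -(addrNK (a * b') (a' * b')) -mulrBl -addrA -mulrBr.
by apply: rpredD; [apply: ideal_genMr | apply: ideal_genMl];
  apply: repr_quot_pi.
Qed.

Lemma quot_piZ c a : quot_pi (c *: a) = quot_scale c (quot_pi a).
Proof.
apply/esym/quot_piP; rewrite -scalerBr -mulr_algl.
by apply: ideal_genMl; apply: repr_quot_pi.
Qed.

Fact quot_mulA : associative quot_mul.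
Proof.
move=> p q r; rewrite -[p]quot_pi_repr -[q]quot_pi_repr -[r]quot_pi_repr.
by rewrite -!quot_piM mulrA.
Qed.

Fact quot_mul1r : left_id quot_one quot_mul.
Proof. by move=> p; rewrite -[p]quot_pi_repr -quot_piM mul1r. Qed.

Fact quot_mulr1 : right_id quot_one quot_mul.
Proof. by move=> p; rewrite -[p]quot_pi_repr -quot_piM mulr1. Qed.

Fact quot_mulDl : left_distributive quot_mul +%R.
Proof.
move=> p q r; rewrite -[p]quot_pi_repr -[q]quot_pi_repr -[r]quot_pi_repr.
by rewrite -quot_piD -!quot_piM mulrDl quot_piD.
Qed.

Fact quot_mulDr : right_distributive quot_mul +%R.
Proof.
move=> p q r; rewrite -[p]quot_pi_repr -[q]quot_pi_repr -[r]quot_pi_repr.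
by rewrite -quot_piD -!quot_piM mulrDr quot_piD.
Qed.

HB.instance Definition _ := GRing.Zmodule_isPzRing.Build Q
  quot_mulA quot_mul1r quot_mulr1 quot_mulDl quot_mulDr.

Fact quot_scaleA a b (q : Q) :
  quot_scale a (quot_scale b q) = quot_scale (a * b) q.
Proof. by rewrite -[q]quot_pi_repr -!quot_piZ scalerA. Qed.

Fact quot_scale1r : left_id 1 quot_scale.
Proof. by move=> q; rewrite -[q]quot_pi_repr -quot_piZ scale1r. Qed.

Fact quot_scaleDr : right_distributive quot_scale +%R.
Proof.
move=> c p q; rewrite -[p]quot_pi_repr -[q]quot_pi_repr.
by rewrite -quot_piD -!quot_piZ scalerDr quot_piD.
Qed.

Fact quot_scaleDl (q : Q) : {morph quot_scale^~ q : a b / a + b}.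
Proof.
by move=> a b; rewrite -[q]quot_pi_repr -!quot_piZ scalerDl quot_piD.
Qed.

HB.instance Definition _ := GRing.Zmodule_isLmodule.Build R Q
  quot_scaleA quot_scale1r quot_scaleDr quot_scaleDl.

Fact quot_pi_is_zmod_morphism : zmod_morphism quot_pi.
Proof.
move=> a b; apply/eqP; rewrite eq_sym subr_eq -quot_piD; apply/eqP.
by rewrite addrNK.
Qed.

HB.instance Definition _ :=
  GRing.isZmodMorphism.Build A Q quot_pi quot_pi_is_zmod_morphism.

Fact quot_pi_is_monoid_morphism : monoid_morphism quot_pi.
Proof. by split=> // a b; rewrite quot_piM. Qed.

HB.instance Definition _ :=
  GRing.isMonoidMorphism.Build A Q quot_pi quot_pi_is_monoid_morphism.

HB.instance Definition _ :=
  GRing.isScalable.Build R A Q *:%R quot_pi quot_piZ.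

End QuotAlg.

(* The free algebra on two letters, as the monoid algebra of words. *)
Definition free2 (R : comNzRingType) := {malg R[{fmonom bool}]}.

Section Free2.
Variable R : comNzRingType.

HB.instance Definition _ := GRing.Lalgebra.on (free2 R).

Definition freeX : free2 R := << fmu false >>.
Definition freeY : free2 R := << fmu true >>.

(* R[X,Y] inside R<X,Y>: the span of the monomials X^i Y^j. *)
Definition ordered_poly (P : free2 R) : Prop :=
  exists (N : nat) (c : nat -> nat -> R),
    P = \sum_(i < N) \sum_(j < N) c i j *: (freeX ^+ i * freeY ^+ j).

Definition word_eval (B : nzRingType) (x y : B) (m : {fmonom bool}) : B :=
  \prod_(b <- (m : seq bool)) (if b then y else x).

(* The R-algebra morphism R<X,Y> -> B with X |-> x and Y |-> y. *)
Definition free_eval (B : algType R) (x y : B) (w : free2 R) : B :=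
  mmap (in_alg B) (word_eval x y) w.

Section WordEval.
Variables (B : nzRingType) (x y : B).

Fact word_eval_is_multiplicative : mmorphism (word_eval x y).
Proof.
split=> [m1 m2|]; first by rewrite /word_eval fmM big_cat.
by rewrite /word_eval fm1 big_nil.
Qed.

HB.instance Definition _ :=
  monalg.isMultiplicative.Build {fmonom bool} B (word_eval x y)
    word_eval_is_multiplicative.

End WordEval.

Section FreeEval.
Variables (B : algType R) (x y : B).
Local Notation ev := (free_eval x y).

Fact free_eval_is_zmod_morphism : zmod_morphism ev.
Proof. exact: mmap_is_additive. Qed.

HB.instance Definition _ :=
  GRing.isZmodMorphism.Build (free2 R) B ev free_eval_is_zmod_morphism.

Fact free_eval_is_monoid_morphism : monoid_morphism ev.
Proof.
suff [evM ev1] : GRing.multiplicative ev by split.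
apply: commr_mmap_is_multiplicative => g m m'.
by rewrite /GRing.comm /= mulr_algl mulr_algr.
Qed.

HB.instance Definition _ :=
  GRing.isMonoidMorphism.Build (free2 R) B ev free_eval_is_monoid_morphism.

Fact free_eval_is_scalable : scalable ev.
Proof. by move=> c w; rewrite /free_eval mmapZ /= mulr_algl. Qed.

HB.instance Definition _ :=
  GRing.isScalable.Build R (free2 R) B *:%R ev free_eval_is_scalable.

Lemma free_evalX : ev freeX = x.
Proof.
by rewrite /free_eval mmapU /= scale1r mul1r /word_eval fmU big_seq1.
Qed.

Lemma free_evalY : ev freeY = y.
Proof.
by rewrite /free_eval mmapU /= scale1r mul1r /word_eval fmU big_seq1.
Qed.

End FreeEval.

(* The R-subalgebra of A generated by x and y is presented, via X |-> x and
   Y |-> y, by the vanishing of the elements of G. *)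
Definition presents (A : algType R) (x y : A) (G : free2 R -> Prop) : Prop :=
  exists phi : {rmorphism quot_alg G -> A},
    [/\ scalable phi, phi (quot_pi G freeX) = x, phi (quot_pi G freeY) = y,
        injective phi &
        forall a, (exists q, phi q = a) <->
                  subalg_gen (fun z => z = x \/ z = y) a].

End Free2.

(* The value at a of a polynomial over R, for a in an R-algebra. *)
Definition poly_at (R : nzRingType) (A : lalgType R) (p : {poly R}) (a : A) : A :=
  (map_poly (in_alg A) p).[a].

Section ExplicitP.
Variables (R : comNzRingType) (n : nat) (f g : {poly R}).

(* Matrices have size n+2; coef_a j is the 1-based (n+2, j)-entry of s(D). *)
Definition coef_a (j : nat) : R :=
  horner_mx (companion_col n.+2 g) (g - f) ord_max (inord j.-1).

Definition explicit_p (j : nat) : {poly R} :=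
  'X^j - \sum_(1 <= i < j.+1) coef_a i *: 'X^(j - i).

Definition explicit_P (j : nat) : free2 R :=
  poly_at (explicit_p j) (freeX R) * (freeX R - freeY R) + freeY R ^+ j.+1.

End ExplicitP.

Definition relators (R : comNzRingType) (n : nat) (f g h : {poly R})
    (P : nat -> free2 R) (w : free2 R) : Prop :=
  [\/ w = poly_at f (freeX R),
      w = poly_at g (freeY R),
      w = poly_at h (freeX R) * (freeX R - freeY R) |
      exists2 j, (1 <= j < n)%N & w = freeY R ^+ j * freeX R - P j].

(* Main.v *)
(* Write f = h d and g = k d.  The relations Y^j X = P_j together with f(X) = 0
   and g(Y) = 0 reorder every word into powers of X followed by powers of Y, and
   h(X) (X - Y) = 0 then leaves the spanning set X^i (i < n), X^i Y^j
   (i < deg h, 0 < j < n).  These monomials stay linearly independent at (C, D):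
   C - D has g - f as its only nonzero column, the last, and R[X] acts through C
   on the cyclic vector e_1 as on R[X]/(f), so a relation forces f | B (g - f)
   for some B with deg B < deg h, that is, h | B (k - h).  By Gauss's lemma h and
   k are coprime over the fraction field of R as well, whence B = 0. *)
From HB Require Import structures.
Require Import Defs.
From mathcomp Require Import all_boot all_order all_algebra monalg.
From mathcomp Require Import boolp ring.
Set Implicit Arguments.
Unset Strict Implicit.
Unset Printing Implicit Defensive.
Import GRing.Theory.
Local Open Scope ring_scope.

(** * Primes and Gauss's lemma over a unique factorization domain *)

Section UniqueFactorization.
Variable R : idomainType.
Hypothesis ufdR : is_ufd R.

Lemma irreducible_eltM (u p : R) :
  u \is a GRing.unit -> irreducible_elt p -> irreducible_elt (u * p).
Proof.
move=> uU [p0 pnU irr_p]; split.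
- by rewrite mulf_neq0 //; apply: contraTneq uU => ->; rewrite unitr0.
- by rewrite unitrM uU.
- move=> b c eq_bc; have [] := irr_p (u^-1 * b) c.
  + by rewrite -mulrA -eq_bc mulKr.
  + by rewrite unitrM unitrV uU; left.
  + by right.
Qed.

Lemma ufd_factor (a : R) : a != 0 ->
  exists u s, [/\ u \is a GRing.unit, forall p, p \in s -> irreducible_elt p &
                  a = u * \prod_(p <- s) p].
Proof.
move=> a0; have [aU | aNU] := boolP (a \is a GRing.unit).
  by exists a, [::]; rewrite big_nil mulr1.
have [s irr_s ->] := ufdR.1 a a0 aNU.
by exists 1, s; rewrite unitr1 mul1r.
Qed.

Lemma irreducible_dvd_prod (p : R) (s : seq R) :
  p \in s -> exists c, \prod_(q <- s) q = p * c.
Proof. by move=> ps; rewrite (big_rem _ ps) /=; eexists. Qed.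

(** Factor [a], [b] and [c] into irreducibles. By uniqueness, [p] is associate to one of the factors
    of [a] or of [b]. *)
Lemma irreducible_prime (p a b c : R) :
  irreducible_elt p -> a * b = p * c ->
  (exists a', a = p * a') \/ (exists b', b = p * b').
Proof.
move=> irr_p eq_ab.
have [->|a0] := eqVneq a 0; first by left; exists 0; rewrite mulr0.
have [->|b0] := eqVneq b 0; first by right; exists 0; rewrite mulr0.
have c0 : c != 0.
  by apply: contraNneq (mulf_neq0 a0 b0) => c0; rewrite eq_ab c0 mulr0.
have [ua [s [uaU irr_s def_a]]] := ufd_factor a0.
have [ub [t [ubU irr_t def_b]]] := ufd_factor b0.
have [uc [w [ucU irr_w def_c]]] := ufd_factor c0.
(* Uniqueness compares equal products of irreducibles, so the three units are collected in [v] and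
   absorbed into [p]. *)
pose v := (ua * ub)^-1 * uc; pose p' := v * p.
have vU : v \is a GRing.unit by rewrite unitrM unitrV unitrM uaU ubU.
have irr_p' : irreducible_elt p' by apply: irreducible_eltM.
have eq_prod : \prod_(q <- p' :: w) q = \prod_(q <- s ++ t) q.
  rewrite big_cons big_cat /=; apply: (@mulrI _ (ua * ub)).
    by rewrite unitrM uaU.
  rewrite [RHS]mulrACA -def_a -def_b eq_ab def_c /p' /v.
  transitivity (ua * ub * (ua * ub)^-1 * (p * (uc * \prod_(q <- w) q))).
    by ring.
  by rewrite divrr ?mul1r // unitrM uaU.
have [||t' [perm_t' sz_t' assoc]] := ufdR.2 _ _ _ _ eq_prod.
- by move=> q; rewrite inE => /orP[/eqP->|/irr_w].
- by move=> q; rewrite mem_cat => /orP[/irr_s|/irr_t].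
have [u uU def_q] := assoc 0%N isT.
have q_st : t'`_0 \in s ++ t by rewrite (perm_mem perm_t') mem_nth // sz_t'.
have dvd_p x y (z : R) : x = y * (t'`_0 * z) -> exists x', x = p * x'.
  move=> ->; exists (y * (u * v * z)); rewrite def_q /= /p'.
  by ring.
move: q_st; rewrite mem_cat => /orP[] /irreducible_dvd_prod[z def_z].
- by left; apply: (dvd_p _ ua z); rewrite -def_z.
- by right; apply: (dvd_p _ ub z); rewrite -def_z.
Qed.

(* Strip leading terms: [p] divides the leading coefficient of [u] or of [v]. *)
Lemma irreducible_prime_poly (p : R) (u v w : {poly R}) :
  irreducible_elt p -> u * v = p *: w ->
  (exists u', u = p *: u') \/ (exists v', v = p *: v').
Proof.
move=> irr_p; move: {2}(size u + size v)%N (leqnn (size u + size v)) => k.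
elim: k u v w => [|k IHk] u v w.
  rewrite leqn0 addn_eq0 size_poly_eq0 => /andP[/eqP-> _] _.
  by left; exists 0; rewrite scaler0.
have drop_lead (q : {poly R}) l : q != 0 -> lead_coef q = p * l ->
    exists q1 m : {poly R}, (size q1 < size q)%N /\ q = q1 + p *: m.
  move=> q0 lead_q.
  exists (q - lead_coef q *: 'X^((size q).-1)), (l *: 'X^((size q).-1)).
  split; last by rewrite lead_q scalerA subrK.
  have sz_q : (0 < size q)%N by rewrite size_poly_gt0.
  rewrite -[ltnRHS](prednK sz_q) ltnS; apply/leq_sizeP => i le_i.
  rewrite coefB coefZ coefXn; case: eqVneq => [->|ne_i].
    by rewrite mulr1 subrr.
  rewrite mulr0 subr0 nth_default // -(prednK sz_q) ltn_neqAle eq_sym ne_i.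
  by [].
have [->|u0] := eqVneq u 0; first by left; exists 0; rewrite scaler0.
have [->|v0] := eqVneq v 0; first by right; exists 0; rewrite scaler0.
move=> le_k eq_uv.
have eq_lead : lead_coef u * lead_coef v = p * lead_coef w.
  by rewrite -lead_coefM eq_uv lead_coefZ.
have [[l lead_u]|[l lead_v]] := irreducible_prime irr_p eq_lead.
- have [u1 [m [lt_u1 def_u]]] := drop_lead u l u0 lead_u.
  have [] := IHk u1 v (w - m * v).
  + by rewrite -ltnS (leq_trans _ le_k) // ltn_add2r.
  + by rewrite scalerBr -eq_uv def_u mulrDl -!scalerAl addrK.
  + by case=> u' def_u1; left; rewrite def_u def_u1 -scalerDr; eexists.
  + by right.
- have [v1 [m [lt_v1 def_v]]] := drop_lead v l v0 lead_v.
  have [] := IHk u v1 (w - u * m).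
  + by rewrite -ltnS (leq_trans _ le_k) // ltn_add2l.
  + by rewrite scalerBr -eq_uv def_v mulrDr -!scalerAr addrK.
  + by left.
  + by case=> v' def_v1; right; rewrite def_v def_v1 -scalerDr; eexists.
Qed.

(* Gauss's lemma: the primes dividing [c] can be cancelled one at a time, each
   from [u] or from [v], until the leading coefficient of what is left of [u]
   divides that of [q]. *)
Lemma monic_associate_of_dvd (c : R) (u v q : {poly R}) :
  c != 0 -> q \is monic -> u * v = c *: q ->
  exists2 e, e \is monic & u = lead_coef u *: e.
Proof.
move=> c0; have [a [s [aU irr_s ->]]] := ufd_factor c0.
(* The unit part of [c] goes into [q], so monic is weakened to a unit leading coefficient. Once no
   primes are left, this makes [lead_coef u] a unit. *)
move=> q_monic; have [q1 q1U ->] : exists2 q1 : {poly R},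
    lead_coef q1 \is a GRing.unit &
    (a * \prod_(p <- s) p) *: q = \prod_(p <- s) p *: q1.
  exists (a *: q); last by rewrite scalerA mulrC.
  by rewrite lead_coefZ (monicP q_monic) mulr1.
elim: s irr_s u v q1 q1U => [|p s IHs] irr_s u v q1 q1U.
  rewrite big_nil scale1r => eq_uv.
  have uU : lead_coef u \is a GRing.unit.
    by move: q1U; rewrite -eq_uv lead_coefM unitrM => /andP[].
  exists ((lead_coef u)^-1 *: u); last by rewrite scalerA divrr // scale1r.
  by rewrite monicE lead_coefZ mulVr.
have irr_p : irreducible_elt p by apply: irr_s; rewrite mem_head.
have {}IHs := IHs (fun x xs => irr_s x (mem_behead (s := p :: s) xs)).
have p0 : p != 0 by case: irr_p.
have scale_pI (x y : {poly R}) : p *: x = p *: y -> x = y.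
  by rewrite -!mul_polyC; apply: mulfI; rewrite polyC_eq0.
rewrite big_cons -scalerA => eq_uv.
have [[u1 def_u]|[v1 def_v]] := irreducible_prime_poly irr_p eq_uv.
- have [|e e_monic def_u1] := IHs u1 v q1 q1U.
    apply: scale_pI; rewrite -eq_uv def_u scalerAl //.
  by exists e => //; rewrite def_u lead_coefZ -scalerA -def_u1.
- apply: (IHs u v1 q1 q1U).
  by apply: scale_pI; rewrite -eq_uv def_v scalerAr.
Qed.

(** [gcdp h k] is a gcd over the fraction field. By Gauss's lemma it is a constant times a monic
    [e], which divides [h] and [k] in R[X]. Then [e * d] is a common divisor of [f] and [g], hence
    divides [d], and [e] is invertible. *)
Lemma coprimep_cofactors (f g d h k : {poly R}) :
  f \is monic -> is_monic_gcd f g d ->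
  f = h * d -> g = k * d -> coprimep h k.
Proof.
move=> f_monic [d_monic _ _ d_gcd] def_f def_g.
have h_monic : h \is monic by rewrite -(monicMr _ d_monic) -def_f.
have [[c1 q1] /= c10 eq1] := Pdiv.Idomain.dvdpP _ _ (dvdp_gcdl h k).
have [e e_monic def_e] : exists2 e, e \is monic &
    gcdp h k = lead_coef (gcdp h k) *: e.
  apply: (monic_associate_of_dvd (v := q1) c10 h_monic).
  by rewrite mulrC -eq1.
have l0 : lead_coef (gcdp h k) != 0.
  by rewrite lead_coef_eq0 gcdp_eq0 negb_and monic_neq0.
have dvd_e q : gcdp h k %| q -> exists r, q = r * e.
  rewrite def_e dvdpZl //.
  exact: (Pdiv.IdomainMonic.dvdpP e_monic).
have [r1 def_h] := dvd_e h (dvdp_gcdl h k).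
have [r2 def_k] := dvd_e k (dvdp_gcdr h k).
have [|| r def_d] := d_gcd (e * d).
- by exists r1; rewrite mulrA -def_h.
- by exists r2; rewrite mulrA -def_k.
rewrite coprimep_def def_e size_scale //.
have d0 := monic_neq0 d_monic; have /eqP : r * e = 1.
  by apply: (mulIf d0); rewrite mul1r -mulrA -def_d.
by rewrite mulrC => /eqP re1; rewrite -dvdp1 -re1 dvdp_mulr.
Qed.

End UniqueFactorization.

(** * The action of a companion matrix on coefficient columns *)

Section Companion.
Variables (R : comNzRingType) (m : nat).
Implicit Types (f g p q : {poly R}).

Local Notation comp := (companion_col m.+1).

(** Coefficients from degree m + 1 on are dropped: for [f] monic of degree m + 1, [- coef_col f]
    holds the coordinates of X^(m+1) modulo [f]. *)
Definition coef_col p : 'cV[R]_m.+1 := \col_i p`_i.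

Lemma coef_colD p q : coef_col (p + q) = coef_col p + coef_col q.
Proof. by apply/matrixP => i j; rewrite !mxE coefD. Qed.

Lemma coef_colN p : coef_col (- p) = - coef_col p.
Proof. by apply/matrixP => i j; rewrite !mxE coefN. Qed.

Lemma coef_col_eq0 p : (size p <= m.+1)%N -> coef_col p = 0 -> p = 0.
Proof.
move=> le_p p0; apply/polyP => i; rewrite coef0.
have [lt_i|le_i] := ltnP i m.+1; last first.
  by rewrite nth_default // (leq_trans le_p).
by have /matrixP/(_ (Ordinal lt_i) 0) := p0; rewrite !mxE.
Qed.

Lemma coef_col_sum p : coef_col p = \sum_(i < m.+1) p`_i *: coef_col 'X^i.
Proof.
apply/matrixP => i j; rewrite summxE mxE (bigD1 i) //= big1 => [|l ne_l].
  by rewrite !mxE coefXn eqxx mulr1 addr0.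
by rewrite !mxE coefXn val_eqE eq_sym (negbTE ne_l) mulr0.
Qed.

Lemma coef_colXn (k : 'I_m.+1) : coef_col 'X^k = delta_mx k 0.
Proof. by apply/matrixP => i j; rewrite !mxE coefXn ord1 eqxx andbT. Qed.

Lemma mx_eq0_coef_col (A : 'M[R]_m.+1) :
  (forall k : 'I_m.+1, A *m coef_col 'X^k = 0) -> A = 0.
Proof.
move=> A0; apply/matrixP => i k; have /matrixP/(_ i 0) := A0 k.
by rewrite coef_colXn -colE !mxE.
Qed.

(* Only the last columns of two companion matrices differ. *)
Lemma companion_colB f g :
  comp f - comp g = coef_col (g - f) *m delta_mx 0 ord_max.
Proof.
apply/matrixP => i j; rewrite mxE [in RHS]mxE big_ord1 !mxE coefB eqSS.
have [->|ne_j] := eqVneq j ord_max; first by rewrite eqxx mulr1 opprK addrC.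
have /negbTE-> : (val j != m)%N.
  by apply: contraNneq ne_j => j_m; apply/eqP/val_inj.
by rewrite subrr mulr0.
Qed.

Lemma companion_mul_coefXn f k : (k < m)%N ->
  comp f *m coef_col 'X^k = coef_col 'X^(k.+1).
Proof.
move=> lt_k; rewrite -[k]/(val (Ordinal (ltnW lt_k : (k < m.+1)%N))).
rewrite coef_colXn -colE.
by apply/matrixP => i j; rewrite !mxE eqSS /= ltn_eqF // coefXn.
Qed.

Lemma companion_mul_coefXm f : comp f *m coef_col 'X^m = - coef_col f.
Proof.
rewrite -[m in 'X^m]/(val (@ord_max m)) coef_colXn -colE.
by apply/matrixP => i j; rewrite !mxE eqxx.
Qed.

Lemma companion_exp_col f k : (k <= m)%N ->
  comp f ^+ k *m coef_col 1 = coef_col 'X^k.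
Proof.
elim: k => [|k IHk] lt_k; first by rewrite expr0 mul1mx.
by rewrite exprS -mulmxE -mulmxA IHk 1?ltnW // companion_mul_coefXn.
Qed.

Lemma companion_expS_col f : comp f ^+ m.+1 *m coef_col 1 = - coef_col f.
Proof.
by rewrite exprS -mulmxE -mulmxA companion_exp_col // companion_mul_coefXm.
Qed.

Lemma horner_mx_sum (A : 'M[R]_m.+1) p b : (size p <= b)%N ->
  horner_mx A p = \sum_(i < b) p`_i *: A ^+ i.
Proof.
move=> le_p; rewrite -[p in LHS](coefK p) poly_def rmorph_sum /=.
rewrite (big_ord_widen _ (fun i => horner_mx A (p`_i *: 'X^i)) le_p).
rewrite big_mkcond /=.
apply: eq_bigr => i _; rewrite linearZ /= rmorphXn /= horner_mx_X.
by case: ltnP => // le_i; rewrite nth_default // scale0r.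
Qed.

(** The column [coef_col 1] is e_1, a cyclic vector: C^k e_1 = e_(k+1) for k at most m. *)
Lemma horner_companion_col f p : (size p <= m.+1)%N ->
  horner_mx (comp f) p *m coef_col 1 = coef_col p.
Proof.
move=> le_p; rewrite (horner_mx_sum _ le_p) mulmx_suml [RHS]coef_col_sum.
apply: eq_bigr => i _.
by rewrite -scalemxAl companion_exp_col // -ltnS.
Qed.

Lemma horner_mx_comm (A : 'M[R]_m.+1) p q (v : 'cV_m.+1) :
  horner_mx A p *m (horner_mx A q *m v) = horner_mx A q *m (horner_mx A p *m v).
Proof. by rewrite !mulmxA !mulmxE -!rmorphM mulrC. Qed.

(** Each basis column is C^k e_1, and f(C) commutes with C^k, so f(C) e_1 = 0 suffices; this is the
    last column of C read off. *)
Lemma companion_annihilated f : f \is monic -> size f = m.+2 ->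
  horner_mx (comp f) f = 0.
Proof.
move=> f_monic sz_f; apply: mx_eq0_coef_col => k.
rewrite -(horner_companion_col f) ?size_polyXn // horner_mx_comm.
rewrite (horner_mx_sum _ (eq_leq sz_f)) big_ord_recr /=.
have -> : f`_m.+1 = 1 by move/monicP: f_monic; rewrite lead_coefE sz_f.
rewrite scale1r mulmxDl companion_expS_col mulmx_suml.
suff <- : \sum_(i < m.+1) f`_i *: comp f ^+ i *m coef_col 1 = coef_col f.
  by rewrite subrr mulmx0.
rewrite [RHS]coef_col_sum; apply: eq_bigr => i _.
by rewrite -scalemxAl companion_exp_col // -ltnS.
Qed.

(** The remainder of [p] modulo [f] also kills e_1, and its coefficients are the entries of its
    value at e_1. *)
Lemma companion_dvd f p : f \is monic -> size f = m.+2 ->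
  horner_mx (comp f) p *m coef_col 1 = 0 -> exists q, p = q * f.
Proof.
move=> f_monic sz_f; rewrite {1}(Pdiv.RingMonic.rdivp_eq f_monic p).
rewrite rmorphD rmorphM /= companion_annihilated // mulr0 add0r.
have lt_r : (size (Pdiv.Ring.rmodp p f) <= m.+1)%N.
  by rewrite -ltnS -sz_f Pdiv.Ring.ltn_rmodpN0 // monic_neq0.
rewrite horner_companion_col // => /(coef_col_eq0 lt_r) r0.
exists (Pdiv.Ring.rdivp p f).
by rewrite {1}(Pdiv.RingMonic.rdivp_eq f_monic p) r0 addr0.
Qed.

End Companion.

(** * Two companion matrices: the cofactor relation and linear independence *)

Section CompanionPair.
Variables (R : comNzRingType) (m : nat) (f g : {poly R}).
Hypotheses (f_monic : f \is monic) (sz_f : size f = m.+2).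
Hypotheses (g_monic : g \is monic) (sz_g : size g = m.+2).
Local Notation C := (companion_col m.+1 f).
Local Notation D := (companion_col m.+1 g).
Local Notation coef_col := (@coef_col R m).

Lemma size_sub_monic : (size (g - f)%R <= m.+1)%N.
Proof.
apply/leq_sizeP => i; rewrite leq_eqVlt coefB => /orP[/eqP<-|lt_i].
  move/monicP: f_monic; move/monicP: g_monic.
  by rewrite !lead_coefE sz_f sz_g /= => -> ->; rewrite subrr.
by rewrite !nth_default ?subrr ?sz_f ?sz_g.
Qed.

(** The nonzero column of C - D is (g - f)(C) e_1, and h (g - f) = (k - h) f is killed at C. *)
Lemma companion_rel_cofactor h d k : f = h * d -> g = k * d ->
  horner_mx C h * (C - D) = 0.
Proof.
move=> def_f def_g; rewrite companion_colB -mulmxE mulmxA.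
rewrite -(horner_companion_col f size_sub_monic) [horner_mx C h *m _]mulmxA.
rewrite mulmxE -rmorphM (_ : h * (g - f) = (k - h) * f).
  by rewrite rmorphM /= companion_annihilated // mulr0 !mul0mx.
by rewrite def_g def_f; ring.
Qed.

Section Independence.
(** Here [b] stands for deg h; the hypothesis below is the form in which the coprimality of the
    cofactors enters. *)
Variable b : nat.
Hypothesis mul_sub_dvd0 :
  forall B : {poly R}, (size B <= b)%N ->
    (exists q, B * (g - f) = q * f) -> B = 0.

(* With N = m + 1, D ^ j and C ^ j agree on e_k when j + k <= N, but differ by
   [coef_col (g - f)] when j + k = N + 1.  Applying the relation to e_1 gives
   (sum B_j X^j)(C) e_1 = 0; applying it to e_(N - J + 1), where J is the last
   index of the sum, then leaves B_J(C) (coef_col (g - f)) = 0, that is, f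
   divides B_J (g - f). *)
Lemma companion_monomials_free (B : nat -> {poly R}) :
    (size (B 0) <= m.+1)%N -> (forall j, (0 < j)%N -> (size (B j) <= b)%N) ->
    \sum_(j < m.+1) horner_mx C (B j) * D ^+ j = 0 ->
  forall j, (j <= m)%N -> B j = 0.
Proof.
(* Induction on the length of the sum: the top coefficient is shown to vanish first, which leaves a
   shorter sum. *)
move=> szB0 szB; suff free J : (J <= m)%N ->
    \sum_(j < J.+1) horner_mx C (B j) * D ^+ j = 0 ->
  forall j, (j <= J)%N -> B j = 0 by apply: free.
elim: J => [_|J IHJ lt_J].
  rewrite big_ord1 expr0 mulr1 => B0 j; rewrite leqn0 => /eqP->.
  apply: (coef_col_eq0 szB0); rewrite -(horner_companion_col f) // B0.
  by rewrite mul0mx.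
rewrite big_ord_recr /= => sumB0.
(* [Q] is the relation with D replaced by C, a harmless change on e_1. *)
pose Q := \sum_(j < J.+2) B j * 'X^j.
have Q_col : horner_mx C Q *m coef_col 1 = 0.
  rewrite -[RHS](mul0mx _ (coef_col 1)) -sumB0.
  rewrite -(big_ord_recr _ (fun j => horner_mx C (B j) * D ^+ j)) /=.
  rewrite rmorph_sum !mulmx_suml; apply: eq_bigr => j _.
  have le_j : (j <= m)%N by rewrite -ltnS (leq_trans (ltn_ord j)).
  rewrite rmorphM /= rmorphXn /= horner_mx_X -!mulmxE -!mulmxA.
  by rewrite !companion_exp_col.
have [k def_m] : exists k, m = (k + J.+1)%N.
  by exists (m - J.+1)%N; rewrite subnK.
have BJ0 : B J.+1 = 0.
  apply: mul_sub_dvd0; first exact: szB.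
  apply: (companion_dvd f_monic sz_f).
  pose v := coef_col 'X^(k.+1).
  have le_k : (k.+1 <= m)%N by rewrite def_m addnS ltnS leq_addr.
  have exp_v (p : {poly R}) j : companion_col m.+1 p ^+ j *m v =
      companion_col m.+1 p ^+ (j + k.+1) *m coef_col 1.
    by rewrite exprD -mulmxE -mulmxA companion_exp_col.
  have Q_v : horner_mx C Q *m v = 0.
    rewrite /v -(companion_exp_col f le_k) -[C in C ^+ _]horner_mx_X.
    by rewrite -rmorphXn /= horner_mx_comm Q_col mulmx0.
  have : (\sum_(j < J.+1) horner_mx C (B j) * D ^+ j +
          horner_mx C (B J.+1) * D ^+ J.+1) *m v - horner_mx C Q *m v = 0.
    by rewrite sumB0 Q_v mul0mx subrr.
  have -> : Q = \sum_(j < J.+1) B j * 'X^j + B J.+1 * 'X^(J.+1).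
    by rewrite /Q big_ord_recr.
  rewrite rmorphD rmorph_sum /= !mulmxDl !mulmx_suml.
  (* For j at most J the exponent j + k + 1 is at most m, so C and D agree and these terms cancel;
     at J + 1 it is exactly m + 1. *)
  set S := \sum_(_ < _) _; rewrite [X in _ - (X + _)](_ : _ = S); last first.
    apply: eq_bigr => j _.
    have le_jk : (j + k.+1 <= m)%N.
      by rewrite def_m addnC addSnnS leq_add2l.
    rewrite rmorphM /= rmorphXn /= horner_mx_X -!mulmxE -!mulmxA !exp_v.
    by rewrite !companion_exp_col.
  rewrite opprD addrACA subrr add0r rmorphM /= rmorphXn /= horner_mx_X.
  rewrite -!mulmxE -!mulmxA !exp_v [(J.+1 + _)%N]addnC addSn -def_m.
  rewrite !companion_expS_col -mulmxBr opprK addrC -coef_colN -coef_colD.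
  move=> B_col; rewrite rmorphM /= -mulmxE -mulmxA.
  rewrite horner_companion_col ?size_sub_monic //.
  by rewrite -opprB coef_colN mulmxN B_col oppr0.
move=> j; rewrite leq_eqVlt => /orP[/eqP->//|]; rewrite ltnS.
apply: IHJ; first exact: ltnW.
by move: sumB0; rewrite BJ0 rmorph0 mul0r addr0.
Qed.

End Independence.
End CompanionPair.

(** * The explicit polynomials and the products D^j C *)

Section ExplicitRelation.
Variables (R : comNzRingType) (n : nat) (f g : {poly R}).
Hypotheses (f_monic : f \is monic) (sz_f : size f = n.+3).
Hypotheses (g_monic : g \is monic) (sz_g : size g = n.+3).
Local Notation C := (companion_col n.+2 f).
Local Notation D := (companion_col n.+2 g).

(** This is the recurrence satisfied by the columns D^j (g - f); at index 0 the empty sum gives the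
    initial value 1. *)
Lemma explicit_pS j : explicit_p n f g j.+1 =
  'X * explicit_p n f g j - (coef_a n f g j.+1)%:P.
Proof.
rewrite /explicit_p big_nat_recr //= subnn expr0 alg_polyC opprD addrA.
rewrite mulrBr -exprS mulr_sumr; congr (_ - _ - _).
apply: eq_big_nat => i /andP[_ lt_i].
by rewrite -scalerAr -exprS subSn.
Qed.

(* Let s be the column of g - f, so that D = C - s e_N^T.  Then
   D^(j+1) s = C D^j s - (e_N^T D^j s) s, and e_N^T D^j s is the last entry of
   (g - f)(D) e_(j+1), which is a_(j+1). *)
Lemma companion_exp_sub j : (j < n.+2)%N ->
  D ^+ j * (C - D) = horner_mx C (explicit_p n f g j) * (C - D).
Proof.
rewrite companion_colB -!mulmxE !mulmxA => lt_j; congr (_ *m _).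
elim: j lt_j => [|j IHj] lt_j.
  by rewrite /explicit_p big_geq // subr0 rmorph1.
have /IHj{}IHj := ltnW lt_j.
rewrite explicit_pS; move: (explicit_p n f g j) IHj => p IHj.
rewrite exprS -mulmxE -mulmxA {1}IHj -[D in D *m _](subKr C) companion_colB.
rewrite mulmxBl mulmxA rmorphB rmorphM /= horner_mx_X horner_mx_C.
rewrite mulmxBl mulmxE; congr (_ - _).
rewrite -IHj -!mulmxA mul_scalar_mx.
have sz_gf := size_sub_monic f_monic sz_f g_monic sz_g.
(* The inner column is rewritten as (g - f)(D) e_1, so that D^j can be moved onto e_1, giving
   e_(j+1). *)
rewrite -{2}(horner_companion_col g sz_gf) -[D in D ^+ j]horner_mx_X -rmorphXn.
rewrite /= horner_mx_comm rmorphXn /= horner_mx_X.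
rewrite companion_exp_col; last exact: ltnW.
rewrite -[j in 'X^j]/(val (Ordinal (ltnW lt_j))) coef_colXn -colE.
have -> (v : 'cV[R]_n.+2) : delta_mx 0 ord_max *m v = (v ord_max 0)%:M :> 'M_1.
  apply/matrixP => i k; rewrite !ord1 !mxE (bigD1 ord_max) //= !mxE !eqxx mul1r.
  by rewrite big1 ?addr0 // => l ne_l; rewrite mxE (negbTE ne_l) mul0r.
rewrite mul_mx_scalar mxE.
have eq_j : Ordinal (ltnW lt_j) = inord j.
  by apply: val_inj; rewrite /= inordK // ltnW.
pose scaled i := horner_mx D (g - f) ord_max i *: coef_col n.+1 (g - f).
exact: (congr1 scaled eq_j).
Qed.

End ExplicitRelation.

(** * The free algebra, its evaluations and a kernel criterion for presentations *)

Fact malg_scalerAr (R : comNzRingType) (K : monomType) (c : R)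
    (u v : {malg R[K]}) :
  c *: (u * v) = u * (c *: v).
Proof.
suff comm_c : c%:MP * u = u * c%:MP.
  by rewrite -(mul_malgC c (u * v)) mulrA comm_c -(mulrA u) (mul_malgC c v).
rewrite (monalgE u) mulr_sumr mulr_suml; apply: eq_bigr => k _.
by rewrite !malgM_def !fgmulUU mul1m mulm1 mulrC.
Qed.

Section FreeAlgebra.
Variable R : comNzRingType.

HB.instance Definition _ :=
  GRing.Lalgebra_isAlgebra.Build R (free2 R) (@malg_scalerAr R {fmonom bool}).

Lemma poly_at_sum (A : lalgType R) (p : {poly R}) (a : A) :
  poly_at p a = \sum_(i < size p) p`_i *: a ^+ i.
Proof.
rewrite /poly_at /map_poly horner_poly.
by apply: eq_bigr => i _; rewrite mulr_algl.
Qed.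

Section PolyAt.
Variables (A : algType R) (a : A).
Implicit Types p q : {poly R}.

Lemma poly_at0 : poly_at (0 : {poly R}) a = 0.
Proof. exact: (rmorph0 (horner_alg a)). Qed.

Lemma poly_at1 : poly_at (1 : {poly R}) a = 1.
Proof. exact: (rmorph1 (horner_alg a)). Qed.

Lemma poly_atX : poly_at ('X : {poly R}) a = a.
Proof. by rewrite /poly_at map_polyX hornerX. Qed.

Lemma poly_atXn k : poly_at ('X^k : {poly R}) a = a ^+ k.
Proof. by rewrite /poly_at map_polyXn hornerXn. Qed.

Lemma poly_atD p q : poly_at (p + q) a = poly_at p a + poly_at q a.
Proof. exact: (rmorphD (horner_alg a)). Qed.

Lemma poly_atM p q : poly_at (p * q) a = poly_at p a * poly_at q a.
Proof. exact: (rmorphM (horner_alg a)). Qed.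

Lemma poly_atZ c p : poly_at (c *: p) a = c *: poly_at p a.
Proof. by rewrite /poly_at map_polyZ hornerZ mulr_algl. Qed.

End PolyAt.

Lemma poly_at_mx m (A : 'M[R]_m.+1) p : poly_at p A = horner_mx A p.
Proof. by rewrite poly_at_sum (horner_mx_sum _ (leqnn _)). Qed.

Lemma free_eval_poly_at (B : algType R) (x y : B) p z :
  free_eval x y (poly_at p z) = poly_at p (free_eval x y z).
Proof.
rewrite !poly_at_sum rmorph_sum; apply: eq_bigr => i _.
by rewrite /= linearZ /= rmorphXn.
Qed.

Lemma free2_span (w : free2 R) :
  w = \sum_(k <- finmap.enum_fset (msupp w)) w@_k *: << k >>.
Proof.
rewrite {1}[w]monalgE; apply: eq_bigr => k _.
by rewrite -mul_malgC malgM_def fgmulUU mulr1 mul1m.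
Qed.

Lemma free2_word_rcons (s : seq bool) b :
  << FMonom (rcons s b) >> =
  << FMonom s >> * (if b then freeY R else freeX R).
Proof.
have -> : (if b then freeY R else freeX R) = << fmu b >> by case: b.
rewrite malgM_def fgmulUU mulr1; congr << _ *g _ >>.
by apply/eqP; rewrite fmP fmM fmU -cats1.
Qed.

(** Letters are appended on the right because the spanning set is shown stable under right
    multiplication. *)
Lemma free2_word_ind (K : free2 R -> Prop) :
  K 1 -> (forall w, K w -> K (w * freeX R)) ->
  (forall w, K w -> K (w * freeY R)) ->
  forall k : {fmonom bool}, K << k >>.
Proof.
move=> K1 KX KY k; rewrite -[k]fmK; elim/last_ind: (fmonom_val k) => [|s b].
  by rewrite -fmoneE.
by rewrite free2_word_rcons; case: b; [apply: KY | apply: KX].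
Qed.

Lemma free_eval_subalg (B : algType R) (x y : B) a :
  (exists w, free_eval x y w = a) <-> subalg_gen (fun z => z = x \/ z = y) a.
Proof.
split=> [[w <-] S [S1 Slin SM] Sxy | a_gen].
  have S0 : 0 \in S by rewrite -(addNr 1) -scaleN1r Slin.
  have Sx : x \in S by apply: Sxy; left.
  have Sy : y \in S by apply: Sxy; right.
  rewrite (free2_span w) rmorph_sum /=.
  elim/big_rec: _ => // k v _ Sv; rewrite linearZ; apply: Slin => //=.
  apply: (free2_word_ind (K := fun u => free_eval x y u \in S)).
  - by rewrite rmorph1.
  - by move=> u Su; rewrite rmorphM /= free_evalX SM.
  - by move=> u Su; rewrite rmorphM /= free_evalY SM.
pose S : {pred B} := fun a => `[< exists w, free_eval x y w = a >].
suff /asboolP : a \in S by [].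
apply: a_gen.
  split.
  - by apply/asboolP; exists 1; rewrite rmorph1.
  - move=> c _ _ /asboolP[u <-] /asboolP[v <-]; apply/asboolP.
    by exists (c *: u + v); rewrite linearP.
  - move=> _ _ /asboolP[u <-] /asboolP[v <-]; apply/asboolP.
    by exists (u * v); rewrite rmorphM.
by move=> _ [->|->]; apply/asboolP; [exists (freeX R) | exists (freeY R)];
  rewrite ?free_evalX ?free_evalY.
Qed.

Lemma free_eval_ideal_gen (B : algType R) (x y : B) (G : free2 R -> Prop) :
  (forall w, G w -> free_eval x y w = 0) ->
  forall w, w \in ideal_gen G -> free_eval x y w = 0.
Proof.
move=> G0 w /asboolP/(_ (fun w => free_eval x y w == 0)) w0; apply/eqP/w0.
  split.
  - by rewrite unfold_in rmorph0.
  - by move=> u v /eqP u0 /eqP v0; rewrite unfold_in rmorphD /= u0 v0 addr0.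
  - by move=> a b u /eqP u0; rewrite unfold_in !rmorphM /= u0 mulr0 mul0r.
by move=> u /G0 u0; apply/eqP.
Qed.

(** The first hypothesis makes evaluation at representatives independent of their choice, hence a
    morphism on the quotient; the second makes it injective. *)
Lemma presents_by_kernel (B : algType R) (x y : B) (G : free2 R -> Prop) :
  (forall w, G w -> free_eval x y w = 0) ->
  (forall w, free_eval x y w = 0 -> quot_pi G w = 0) ->
  presents x y G.
Proof.
move=> G0 ker0.
pose phi (q : quot_alg G) : B := free_eval x y (repr q).
have phi_pi w : phi (quot_pi G w) = free_eval x y w.
  have /eqP := free_eval_ideal_gen G0 (repr_quot_pi G w).
  by rewrite rmorphB subr_eq0 => /eqP.
have phi_zmod : zmod_morphism phi.
  move=> p q; rewrite -[p]quot_pi_repr -[q]quot_pi_repr.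
  by rewrite -rmorphB !phi_pi rmorphB.
have phi_monoid : monoid_morphism phi.
  split; first by rewrite -(rmorph1 (quot_pi G)) phi_pi rmorph1.
  move=> p q; rewrite -[p]quot_pi_repr -[q]quot_pi_repr.
  by rewrite -rmorphM !phi_pi rmorphM.
pose phiZ := GRing.isZmodMorphism.Build _ _ phi phi_zmod.
pose phiM := GRing.isMonoidMorphism.Build _ _ phi phi_monoid.
pose phiR : {rmorphism quot_alg G -> B} := HB.pack phi phiZ phiM.
exists phiR; split; rewrite /= ?phi_pi ?free_evalX ?free_evalY //.
- by move=> c q; rewrite -[q]quot_pi_repr -linearZ /= !phi_pi linearZ.
- move=> p q eq_pq; have /ker0 : free_eval x y (repr p - repr q) = 0.
    by rewrite rmorphB; apply/eqP; rewrite subr_eq0; apply/eqP.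
  by rewrite rmorphB /= !quot_pi_repr => /eqP; rewrite subr_eq0 => /eqP.
- move=> a; rewrite -free_eval_subalg; split=> [[q <-]|[w <-]].
    by exists (repr q).
  by exists (quot_pi G w); rewrite /= phi_pi.
Qed.

End FreeAlgebra.

(** The difference is - a (b (x - y)) z. With b = h(X), this trades a Y standing right after a
    multiple of h(X) for an X. *)
Lemma ideal_gen_swap (R : comNzRingType) (A : lalgType R) (G : A -> Prop)
    (a b c x y z : A) :
  b * (x - y) \in ideal_gen G ->
  (a * b + c) * (y * z) - (a * b * x * z + c * (y * z)) \in ideal_gen G.
Proof.
move=> bxy; rewrite mulrDl opprD addrACA subrr addr0 !mulrA -mulrBl -mulrBr.
rewrite -opprB mulrN mulNr rpredN -[a * b * _]mulrA.
by apply: ideal_genMr; apply: ideal_genMl.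
Qed.

(** * Reduction of every word to normal form modulo the relators *)

Section Spanning.
Variables (R : comNzRingType) (m b : nat) (f g h : {poly R}).
Variables (P : nat -> free2 R) (G : free2 R -> Prop).
Hypotheses (f_monic : f \is monic) (sz_f : size f = m.+2).
Hypotheses (g_monic : g \is monic) (sz_g : size g = m.+2).
Hypotheses (h_monic : h \is monic) (sz_h : size h = b.+1).
Local Notation X := (freeX R).
Local Notation Y := (freeY R).
Local Notation pi := (quot_pi G).
Hypothesis fX0 : poly_at f X \in ideal_gen G.
Hypothesis gY0 : poly_at g Y \in ideal_gen G.
Hypothesis hX0 : poly_at h X * (X - Y) \in ideal_gen G.
Hypothesis YX : forall j, (1 <= j < m.+1)%N -> pi (Y ^+ j * X) = pi (P j).

Definition ordered_term (p : {poly R}) (j : nat) : free2 R :=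
  poly_at p X * Y ^+ j.

Lemma pi_mulr u v w : pi u = pi v -> pi (u * w) = pi (v * w).
Proof. by move=> /quot_piP uv; apply/quot_piP; rewrite -mulrBl ideal_genMr. Qed.

Lemma pi_mull u v w : pi u = pi v -> pi (w * u) = pi (w * v).
Proof. by move=> /quot_piP uv; apply/quot_piP; rewrite -mulrBr ideal_genMl. Qed.

Lemma ordered_term0 p : ordered_term p 0 = poly_at p X.
Proof. by rewrite /ordered_term expr0 mulr1. Qed.

Definition bounded (B : nat -> {poly R}) : Prop :=
  (size (B 0) <= m.+1)%N /\ forall j, (0 < j)%N -> (size (B j) <= b)%N.

(* The normal forms modulo the relators: [X^i Y^j] with [i < deg h] if [j > 0],
   and [i < deg f] if [j = 0]. *)
Definition in_span (w : free2 R) : Prop :=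
  exists2 B, bounded B & pi w = pi (\sum_(j < m.+1) ordered_term (B j) j).

Lemma in_span_eq u w : pi u = pi w -> in_span w -> in_span u.
Proof. by move=> eq_uw [B bB eq_w]; exists B; rewrite ?eq_uw. Qed.

Lemma in_spanD u w : in_span u -> in_span w -> in_span (u + w).
Proof.
move=> [A [A0 bA] eq_u] [B [B0 bB] eq_w]; exists (fun j => A j + B j).
  split=> [|j j_gt0]; rewrite (leq_trans (size_polyD _ _)) // geq_max.
    by rewrite A0.
  by rewrite bA // bB.
rewrite quot_piD eq_u eq_w -quot_piD -big_split /=; congr (pi _).
by apply: eq_bigr => j _; rewrite /ordered_term poly_atD mulrDl.
Qed.

Lemma in_spanZ c w : in_span w -> in_span (c *: w).
Proof.
move=> [B [B0 bB] eq_w]; exists (fun j => c *: B j).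
  split=> [|j j_gt0]; rewrite (leq_trans (size_scale_leq _ _)) //.
  exact: bB.
rewrite quot_piZ eq_w -quot_piZ scaler_sumr; congr (pi _).
by apply: eq_bigr => j _; rewrite /ordered_term poly_atZ scalerAl.
Qed.

Lemma in_span0 : in_span 0.
Proof.
exists (fun=> 0); first by split=> [|j _]; rewrite size_poly0.
by rewrite big1 // => j _; rewrite /ordered_term poly_at0 mul0r.
Qed.

Lemma in_span_sum (I : Type) (r : seq I) (K : pred I) (F : I -> free2 R) :
  (forall i, K i -> in_span (F i)) -> in_span (\sum_(i <- r | K i) F i).
Proof.
move=> spanF; elim/big_rec: _ => [|i w Ki span_w]; first exact: in_span0.
by apply: in_spanD => //; apply: spanF.
Qed.

Lemma in_span_bounded (p : {poly R}) j : (j < m.+1)%N ->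
  (size p <= if j == 0%N then m.+1 else b)%N -> in_span (ordered_term p j).
Proof.
move=> lt_j sz_p; exists (fun i => if i == j then p else 0).
  split=> [|i i_gt0]; last first.
    case: eqVneq => [eq_ij|_]; last by rewrite size_poly0.
    by move: sz_p; rewrite -eq_ij gtn_eqF.
  by case: eqVneq sz_p => // _ _; rewrite size_poly0.
rewrite (bigD1 (Ordinal lt_j)) //= eqxx big1 ?addr0 // => i ne_i.
rewrite -val_eqE /= in ne_i.
by rewrite (negbTE ne_i) /ordered_term poly_at0 mul0r.
Qed.

Lemma poly_at_divp (p q : {poly R}) : q \is monic ->
  poly_at p X = poly_at (Pdiv.Ring.rdivp p q) X * poly_at q X +
    poly_at (Pdiv.Ring.rmodp p q) X.
Proof.
move=> q_monic; rewrite {1}(Pdiv.RingMonic.rdivp_eq q_monic p).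
by rewrite poly_atD poly_atM.
Qed.

Lemma pi_YN : pi (Y ^+ m.+1) = pi (\sum_(i < m.+1) (- g`_i) *: Y ^+ i).
Proof.
move: gY0; rewrite poly_at_sum sz_g big_ord_recr /=.
have -> : g`_m.+1 = 1 by move/monicP: g_monic; rewrite lead_coefE sz_g.
rewrite scale1r => gY.
apply/quot_piP; under eq_bigr do rewrite scaleNr.
by rewrite sumrN opprK addrC.
Qed.

(* g lowers the power of Y, f the degree in X of the terms without Y, and
   h(X) Y = h(X) X trades a factor Y for a factor X. *)
Lemma in_span_ordered (p : {poly R}) j : in_span (ordered_term p j).
Proof.
elim/ltn_ind: j p => j IHj p.
have [le_j|lt_j] := ltnP m j.
  pose low := \sum_(i < m.+1) - g`_i *: ordered_term p (i + (j - m.+1)).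
  apply: (@in_span_eq _ low).
    rewrite /low /ordered_term -{1}(subnKC le_j) exprD mulrA.
    rewrite (pi_mulr _ (pi_mull _ pi_YN)).
    rewrite mulr_sumr mulr_suml; congr (pi _); apply: eq_bigr => i _.
    by rewrite exprD -scalerAr -scalerAl mulrA.
  apply: in_span_sum => i _; apply: in_spanZ; apply: IHj.
  by rewrite -{2}(subnKC le_j) ltn_add2r.
case: j => [|j] in IHj lt_j *.
  apply: (@in_span_eq _ (ordered_term (Pdiv.Ring.rmodp p f) 0)).
    apply/quot_piP; rewrite !ordered_term0 (poly_at_divp p f_monic).
    by rewrite addrK ideal_genMl.
  apply: in_span_bounded => //=.
  by rewrite -ltnS -sz_f Pdiv.Ring.ltn_rmodpN0 ?monic_neq0.
pose q := Pdiv.Ring.rdivp p h; pose r := Pdiv.Ring.rmodp p h.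
(* Write p = q h + r. The first term has a larger degree in X but a smaller power of Y, and the
   induction hypothesis holds for every polynomial in X. *)
apply: (@in_span_eq _ (ordered_term (q * h * 'X) j + ordered_term r j.+1)).
  apply/quot_piP; rewrite /ordered_term (poly_at_divp p h_monic) exprS.
  rewrite !poly_atM poly_atX.
  exact: ideal_gen_swap.
apply: in_spanD; first exact: IHj.
apply: in_span_bounded => //=.
by rewrite -ltnS -sz_h Pdiv.Ring.ltn_rmodpN0 ?monic_neq0.
Qed.

Lemma in_spanMY w : in_span w -> in_span (w * Y).
Proof.
case=> B _ eq_w.
apply: (@in_span_eq _ (\sum_(j < m.+1) ordered_term (B j) j.+1)).
  apply: etrans (pi_mulr Y eq_w) _; congr (pi _).
  rewrite mulr_suml.
  by apply: eq_bigr => j _; rewrite /ordered_term exprSr mulrA.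
by apply: in_span_sum => j _; apply: in_span_ordered.
Qed.

Lemma in_span_ordered_poly (p : {poly R}) u :
  ordered_poly u -> in_span (poly_at p X * u).
Proof.
move=> [N [c ->]]; rewrite mulr_sumr; apply: in_span_sum => i _.
rewrite mulr_sumr; apply: in_span_sum => j _.
rewrite -scalerAr mulrA -poly_atXn -poly_atM; apply: in_spanZ.
exact: in_span_ordered.
Qed.

(** Expanding gives three ordered terms: p q X, - p q Y and p Y^j. *)
Lemma in_span_explicit (p q : {poly R}) j :
  in_span (poly_at p X * (poly_at q X * (X - Y) + Y ^+ j)).
Proof.
have -> : poly_at p X * (poly_at q X * (X - Y) + Y ^+ j) =
    ordered_term (p * q * 'X) 0 + (-1) *: ordered_term (p * q) 1 +
    ordered_term p j.
  rewrite ordered_term0 /ordered_term !poly_atM poly_atX expr1 scaleN1r.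
  by rewrite mulrDr mulrA mulrBr.
by do 2?[apply: in_spanD]; try apply: in_spanZ; apply: in_span_ordered.
Qed.

(** Both the explicit P_j and arbitrary ordered ones enter the spanning argument through this
    property. *)
Hypothesis spanP : forall j p, (1 <= j < m.+1)%N -> in_span (poly_at p X * P j).

(** In the terms with j > 0, Y^j X becomes P_j behind a polynomial in X; the term j = 0 only gains a
    degree in X. *)
Lemma in_spanMX w : in_span w -> in_span (w * X).
Proof.
case=> B _ eq_w.
apply: (@in_span_eq _ (\sum_(j < m.+1) ordered_term (B j) j * X)).
  by apply: etrans (pi_mulr X eq_w) _; congr (pi _); rewrite mulr_suml.
apply: in_span_sum => -[[|j] lt_j] _ /=.
  rewrite ordered_term0 -[X in _ * X](poly_atX X) -poly_atM -ordered_term0.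
  exact: in_span_ordered.
have j_range : (1 <= j.+1 < m.+1)%N by [].
apply: in_span_eq (spanP (B j.+1) j_range).
by rewrite /ordered_term -mulrA; apply: pi_mull; apply: YX.
Qed.

Lemma in_span_all w : in_span w.
Proof.
rewrite (free2_span w); apply: in_span_sum => k _; apply: in_spanZ.
apply: free2_word_ind; [|exact: in_spanMX|exact: in_spanMY].
by have := in_span_ordered 1 0; rewrite /ordered_term poly_at1 mulr1.
Qed.

End Spanning.

(** * The presentation, from coprimality, spanning and independence *)

(* The matrix size n.+2 ranges over the integers at least 2. *)
Theorem theorem9p3 (R : idomainType) (n : nat) (f g d h : {poly R})
    (C D : 'M[R]_n.+2) (P : nat -> free2 R) :
  is_ufd R ->
  f \is monic -> size f = n.+3 ->
  g \is monic -> size g = n.+3 ->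
  C = companion_col n.+2 f ->
  D = companion_col n.+2 g ->
  is_monic_gcd f g d -> f = h * d ->
  (forall j, (1 <= j < n.+2)%N -> P j = explicit_P n f g j) \/
  (forall j, (1 <= j < n.+2)%N ->
     ordered_poly (P j) /\ D ^+ j * C = free_eval C D (P j)) ->
  presents C D (relators n.+2 f g h P).
Proof.
move=> ufdR f_monic sz_f g_monic sz_g def_C def_D gcd_d def_f P_cases.
have [d_monic _ [k def_g] _] := gcd_d.
have h_monic : h \is monic by rewrite -(monicMr _ d_monic) -def_f.
have coprime_hk := coprimep_cofactors ufdR f_monic gcd_d def_f def_g.
have sz_h : size h = (size h).-1.+1.
  by rewrite prednK // size_poly_gt0 monic_neq0.
have mul_sub_dvd0 (B : {poly R}) : (size B <= (size h).-1)%N ->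
    (exists q, B * (g - f) = q * f) -> B = 0.
  move=> sz_B [q eq_q].
  (* From B g = (q + B) f, cancel [d]. Then [h] divides [B] over the fraction field, and comparing
     degrees forces B = 0. *)
  have eq_Bk : B * k = (q + B) * h.
    apply: (mulIf (monic_neq0 d_monic)).
    rewrite -mulrA -def_g -mulrA -def_f mulrDl -eq_q.
    by rewrite mulrBr subrK.
  have h_B : h %| B by rewrite -(Gauss_dvdpl _ coprime_hk) eq_Bk dvdp_mull.
  apply/eqP; apply: contraTT sz_B => B0.
  by rewrite -ltnNge -sz_h dvdp_leq.
have relators0 w : relators n.+2 f g h P w -> free_eval C D w = 0.
  case=> [-> | -> | -> | [j lt_j ->]].
  - rewrite free_eval_poly_at free_evalX poly_at_mx def_C.
    exact: companion_annihilated.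
  - rewrite free_eval_poly_at free_evalY poly_at_mx def_D.
    exact: companion_annihilated.
  - rewrite rmorphM rmorphB /= free_eval_poly_at free_evalX free_evalY.
    rewrite poly_at_mx def_C def_D.
    exact: (companion_rel_cofactor _ _ _ _ def_f def_g).
  - rewrite rmorphB rmorphM rmorphXn /= free_evalX free_evalY.
    case: P_cases => [/(_ j lt_j)-> | /(_ j lt_j)[_ ->]]; last exact: subrr.
    rewrite /explicit_P rmorphD rmorphM rmorphXn rmorphB /= free_eval_poly_at.
    rewrite free_evalX free_evalY poly_at_mx.
    have /andP[_ lt_jn] := lt_j.
    (* D^j C = D^j (C - D) + D^(j+1), and p_j(C) acts on C - D as D^j does. *)
    rewrite def_C def_D -companion_exp_sub // -def_C -def_D.
    by rewrite mulrBr exprSr subrK subrr.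
apply: presents_by_kernel => // w w0.
have fX0 : poly_at f (freeX R) \in ideal_gen (relators n.+2 f g h P).
  by apply/asboolP => I _; apply; apply: Or41.
have gY0 : poly_at g (freeY R) \in ideal_gen (relators n.+2 f g h P).
  by apply/asboolP => I _; apply; apply: Or42.
have hX0 : poly_at h (freeX R) * (freeX R - freeY R) \in
    ideal_gen (relators n.+2 f g h P).
  by apply/asboolP => I _; apply; apply: Or43.
have YX j : (1 <= j < n.+2)%N -> quot_pi (relators n.+2 f g h P)
    (freeY R ^+ j * freeX R) = quot_pi (relators n.+2 f g h P) (P j).
  move=> lt_j; apply/quot_piP/asboolP => I _; apply; apply: Or44.
  by exists j.
have spanP j p : (1 <= j < n.+2)%N ->
    in_span n.+1 (size h).-1 (relators n.+2 f g h P)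
      (poly_at p (freeX R) * P j).
  move=> lt_j; case: P_cases => [/(_ j lt_j)-> | /(_ j lt_j)[ordP _]].
    exact: in_span_explicit sz_f g_monic sz_g h_monic sz_h fX0 gY0 hX0 _ _ _.
  exact: in_span_ordered_poly sz_f g_monic sz_g h_monic sz_h fX0 gY0 hX0 _ _ _.
have [B [B0 bB] eq_w] :=
  in_span_all f_monic sz_f g_monic sz_g h_monic sz_h fX0 gY0 hX0 YX spanP w.
(* The normal form of [w] has the same value at (C, D) as [w], namely 0, so independence makes all
   its coefficients vanish. *)
have sum0 : \sum_(j < n.+2) horner_mx C (B j) * D ^+ j = 0.
  transitivity (free_eval C D (\sum_(j < n.+2) ordered_term (B j) j)).
    rewrite rmorph_sum; apply: eq_bigr => j _.
    rewrite /ordered_term rmorphM rmorphXn /= free_eval_poly_at.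
    by rewrite free_evalX free_evalY poly_at_mx.
  move/quot_piP/(free_eval_ideal_gen relators0): eq_w.
  move: (\sum_(_ < _) _) => u.
  by rewrite rmorphB /= w0 sub0r => /eqP; rewrite oppr_eq0 => /eqP.
rewrite def_C def_D in sum0.
have B_eq0 := companion_monomials_free f_monic sz_f g_monic sz_g
  mul_sub_dvd0 B0 bB sum0.
rewrite eq_w big1 ?rmorph0 // => j _.
by rewrite B_eq0 1?/ordered_term ?poly_at0 ?mul0r // -ltnS.
Qed.
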